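(* Let $G$, $\Theta$, $\mathcal H$, $\{\rho_\theta\}$, $\overline{\mathcal Q}=\{\bar\rho_\eta:\eta\in\Theta/G\}$, $\mathcal A_G$, and the finite block decomposition $\mathcal H=\bigoplus_{z\in\mathsf Z}\mathcal H_z$ with central projections $\Pi_z$ be as described in the context, and put $p_\eta(z):=\operatorname{Tr}(\bar\rho_\eta\Pi_z)$. Suppose that: 1. $\mathcal H$ is finite dimensional; 2. (block-coordinate identifiability) if $a:\mathsf Z\to\mathbb R$ satisfies $\sum_{z\in\mathsf Z}p_\eta(z)a(z)=0$ for every $\eta\in\Theta/G$, then $a(z)=0$ for every $z\in\mathsf Z$; 3. the block-label measurement $M^\star(\{z\})=\Pi_z$, $z\in\mathsf Z$, is quantum-to-classically sufficient for $\overline{\mathcal Q}$ relative to all $G$-invariant POVMs. Then there exist density operators $\tau_z$, supported on $\mathcal H_z$ and independent of $\eta$, such that $$\bar\rho_\eta=\bigoplus_{z\in\mathsf Z}p_\eta(z)\,\tau_z\qquad\text{for every }\eta\in\Theta/G.$$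
   Context: **Symmetric model.** $G$ is a compact Hausdorff group with normalized Haar measure $dg$, acting measurably on a parameter space $\Theta$; $g\mapsto U_g$ is a strongly continuous unitary representation of $G$ on a separable complex Hilbert space $\mathcal H$; $\{\rho_\theta:\theta\in\Theta\}$ is a family of density operators on $\mathcal H$ with $\rho_{g\theta}=U_g\rho_\theta U_g^\dagger$ for all $g,\theta$. $\Theta/G$ is the orbit space and $\pi:\Theta\to\Theta/G$ the quotient map. The orbit-averaged state is $\bar\rho_\eta:=\int_G U_g\rho_\theta U_g^\dagger\,dg$ for any $\theta$ with $\pi(\theta)=\eta$; it does not depend on the choice of $\theta$. **Blocks.** $\mathcal A_G:=\{A\in\mathcal L(\mathcal H):[A,U_g]=0\ \forall g\in G\}$, where $\mathcal L(\mathcal H)$ denotes the bounded operators. $\mathsf Z$ is a finite set and $\mathcal H=\bigoplus_{z\in\mathsf Z}\mathcal H_z$ is an orthogonal decomposition into nonzero subspaces whose orthogonal projections $\Pi_z$ are central in $\mathcal A_G$. **POVMs and sufficiency.** A POVM $M$ on $\mathcal H$ with outcome space $(\mathsf Y,\mathcal Y)$ is a map from $\mathcal Y$ to positive bounded operators that is countably additive in the weak operator topology, with $M(\mathsf Y)=I$; outcome spaces are standard Borel. $M$ is $G$-invariant if $U_g^\dagger M(B)U_g=M(B)$ for all $g$ and $B$. For a family of states $\mathcal Q=\{\sigma_\eta\}$, put $P^M_\eta(B):=\operatorname{Tr}[\sigma_\eta M(B)]$. A measurement $M^\star$ in a class $\mathfrak M$ of POVMs is *quantum-to-classically sufficient*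 for $\mathcal Q$ relative to $\mathfrak M$ if for every $N\in\mathfrak M$ there is a Markov kernel $K_N$ (not depending on $\eta$) from the outcome space of $M^\star$ to that of $N$ with $P^N_\eta(B)=\int K_N(x,B)\,P^{M^\star}_\eta(dx)$ for all $\eta$ and all measurable $B$. *)

(* Defs.v *)
From HB Require Import structures.
From mathcomp Require Import all_boot all_order all_algebra.
From mathcomp Require Import spectral sesquilinear.
From mathcomp Require Import complex.
From mathcomp Require Import all_classical all_reals all_analysis.
From mathcomp Require Import measurable_realfun.

Set Implicit Arguments.
Unset Strict Implicit.
Unset Printing Implicit Defensive.

Import Order.TTheory GRing.Theory Num.Theory.
Import numFieldNormedType.Exports.

Local Open Scope classical_set_scope.
Local Open Scope ring_scope.
Local Open Scope complex_scope.
Local Open Scope sesquilinear_scope.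

HB.mixin Record isTopologicalGroup G of Topological G & Group G := {
  mulg_continuous : continuous (fun p : G * G => (p.1 * p.2)%g) ;
  invg_continuous : continuous (fun x : G => (x^-1)%g)
}.

(* The library only builds sigma-algebras on pointed types. *)
#[short(type="topGroupType")]
HB.structure Definition TopologicalGroup :=
  {G of PointedTopological G & Group G & isTopologicalGroup G}.

Notation borel T := (g_sigma_algebraType (@open T)).

Section Haar.
Context (R : realType) (G : topGroupType).

(* Normalization is in the type [probability]. The Haar measure of a compact
   group is invariant on both sides (compact groups are unimodular); regularity
   singles it out when G is not metrizable. *)
Record is_haar (mu : probability (borel G) R) : Prop := {
  haar_left : forall (g : G) (A : set (borel G)), measurable A ->
    mu [set (g * x)%g | x in (A : set G)] = mu A ;
  haar_right : forall (g : G) (A : set (borel G)), measurable A ->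
    mu [set (x * g)%g | x in (A : set G)] = mu A ;
  haar_outer : forall A : set (borel G), measurable A ->
    mu A = ereal_inf [set mu V | V in [set V : set G | open V /\ A `<=` V]] ;
  haar_inner : forall V : set G, open V ->
    mu V = ereal_sup [set mu K | K in [set K : set G | compact K /\ K `<=` V]]
}.

End Haar.

Section Operators.
Context (R : realType) (n : nat).

(* Operators on the Hilbert space C^n act on column vectors; the inner product
   is conjugate-linear in the first argument. *)
Definition inner (u v : 'cV[R[i]]_n) : R[i] := (u^t* *m v) 0 0.

(* [0 <= z] in R[i] means that z is real and nonnegative. *)
Definition positive_op (A : 'M[R[i]]_n) : Prop :=
  forall v : 'cV[R[i]]_n, 0 <= inner v (A *m v).

Definition density (A : 'M[R[i]]_n) : Prop := positive_op A /\ \tr A = 1.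

Definition orth_proj (P : 'M[R[i]]_n) (V : {vspace 'cV[R[i]]_n}) : Prop :=
  forall v, P *m v \in V /\ (forall w, w \in V -> inner w (v - P *m v) = 0).

(* For a positive A the range is the orthogonal complement of the kernel. *)
Definition supported_on (A : 'M[R[i]]_n) (V : {vspace 'cV[R[i]]_n}) : Prop :=
  forall v : 'cV[R[i]]_n, A *m v \in V.

Definition orth_decomposition (Z : finType)
    (V : Z -> {vspace 'cV[R[i]]_n}) : Prop :=
  [/\ forall z, V z != 0%VS,
      forall z w u v, z != w -> u \in V z -> v \in V w -> inner u v = 0
    & (\sum_z V z)%VS = fullv].

(* For a positive A and a density operator s, tr (s A) is real, so that [Re]
   only changes the type. *)
Definition born (s A : 'M[R[i]]_n) : R := complex.Re (\tr (s *m A)).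

End Operators.

Section Representation.
Context (R : realType) (G : topGroupType) (n : nat).
Implicit Types (U : G -> 'M[R[i]]_n).

Record unitary_rep U : Prop := {
  rep1 : U 1%g = 1%:M ;
  repM : forall g h : G, U (g * h)%g = U g *m U h ;
  rep_unitary : forall g, U g \is unitarymx ;
  rep_continuous : forall v : 'cV[R[i]]_n,
    continuous (fun g : G => U g *m v : 'cV[R[i]^o]_n)
}.

Definition commutant U : set 'M[R[i]]_n :=
  [set A | forall g, A *m U g = U g *m A].

Definition central_in (S : set 'M[R[i]]_n) (P : 'M[R[i]]_n) : Prop :=
  S P /\ forall A, S A -> P *m A = A *m P.

Definition cintegral d (T : measurableType d) (mu : {measure set T -> \bar R})
    (f : T -> R[i]) : R[i] :=
  (\int[mu]_(x in setT) complex.Re (f x)) +i*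
  (\int[mu]_(x in setT) complex.Im (f x)).

Definition twirl (mu : probability (borel G) R) U (r : 'M[R[i]]_n) :
    'M[R[i]]_n :=
  \matrix_(i, j) cintegral mu (fun g => (U g *m r *m (U g)^t*) i j).

End Representation.

Section Orbits.
Context (G : topGroupType) (d : measure_display) (Theta : measurableType d).
Implicit Types (act : G -> Theta -> Theta).

Record measurable_action act : Prop := {
  act1 : forall t, act 1%g t = t ;
  actM : forall g h t, act (g * h)%g t = act g (act h t) ;
  act_measurable : measurable_fun setT
    (fun p : borel G * Theta => act p.1 p.2)
}.

Definition orbit act (t : Theta) : set Theta := [set act g t | g in [set: G]].

Definition orbit_space act : Type :=
  {E : set Theta | exists t, E = orbit act t}.

Definition orbit_map act (t : Theta) : orbit_space act :=
  exist _ (orbit act t) (ex_intro _ t erefl).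

Definition orbit_repr act (eta : orbit_space act) : Theta :=
  projT1 (cid (proj2_sig eta)).

Lemma orbit_reprK act : cancel (@orbit_repr act) (orbit_map act).
Proof.
case=> E hE; apply: eq_exist; rewrite /orbit_repr /=.
by case: cid => t /= ->.
Qed.

End Orbits.

Section OrbitAverage.
Context (R : realType) (G : topGroupType) (d : measure_display)
  (Theta : measurableType d) (n : nat)
  (mu : probability (borel G) R) (act : G -> Theta -> Theta)
  (U : G -> 'M[R[i]]_n) (rho : Theta -> 'M[R[i]]_n).

(* Computed at a chosen point of the orbit; by [orbit_avgE] below, every point
   gives the same value. *)
Definition orbit_avg (eta : orbit_space act) : 'M[R[i]]_n :=
  twirl mu U (rho (orbit_repr eta)).

End OrbitAverage.

Section BorelMeasurability.
Context (R : realType) (G : topGroupType).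

Lemma continuous_borel (T : ptopologicalType) (f : G -> T) :
  continuous f -> measurable_fun setT (f : borel G -> borel T).
Proof.
move=> /continuousP cf; apply: (@measurability _ _ (borel G) (borel T) setT f (@open T) erefl).
move=> _ [B oB <-]; rewrite setTI.
by apply: sub_sigma_algebra; exact: cf.
Qed.

Lemma continuous_borel_real (f : G -> R) :
  continuous f -> measurable_fun setT (f : borel G -> R).
Proof.
move=> /continuousP cf.
apply: (measurability _ (RGenOpens.measurableE R)) => _ [_ [x [y ->]] <-].
by rewrite setTI; apply: sub_sigma_algebra; apply: cf; exact: interval_open.
Qed.

Definition cmeasurable (f : borel G -> R[i]) : Prop :=
  measurable_fun setT (fun x => complex.Re (f x)) /\
  measurable_fun setT (fun x => complex.Im (f x)).

Lemma normc_geP (z : R[i]) (e : R) : `|z| < e%:C ->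
  `|complex.Re z| < e /\ `|complex.Im z| < e.
Proof.
case: z => a b; rewrite normc_def ltcR /= => ze.
by split; apply: le_lt_trans ze; rewrite -sqrtr_sqr ler_wsqrtr// ?lerDl ?lerDr sqr_ge0.
Qed.

Lemma cmeasurable_cst c : cmeasurable (fun=> c).
Proof. by split; exact: measurable_cst. Qed.

Lemma cmeasurableD f g : cmeasurable f -> cmeasurable g ->
  cmeasurable (fun x => f x + g x).
Proof.
move=> [fr fi] [gr gi]; split.
- rewrite (_ : (fun _ => _) = (fun x => complex.Re (f x) + complex.Re (g x))).
    exact: measurable_funD.
  by apply/funext => x; case: (f x) (g x) => [? ?] [? ?].
- rewrite (_ : (fun _ => _) = (fun x => complex.Im (f x) + complex.Im (g x))).
    exact: measurable_funD.
  by apply/funext => x; case: (f x) (g x) => [? ?] [? ?].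
Qed.

Lemma cmeasurableM f g : cmeasurable f -> cmeasurable g ->
  cmeasurable (fun x => f x * g x).
Proof.
move=> [fr fi] [gr gi]; split.
- rewrite (_ : (fun _ => _) = (fun x => complex.Re (f x) * complex.Re (g x) -
     complex.Im (f x) * complex.Im (g x))).
    by apply: measurable_funB; exact: measurable_funM.
  by apply/funext => x; case: (f x) (g x) => [? ?] [? ?].
- rewrite (_ : (fun _ => _) = (fun x => complex.Re (f x) * complex.Im (g x) +
     complex.Im (f x) * complex.Re (g x))).
    by apply: measurable_funD; exact: measurable_funM.
  by apply/funext => x; case: (f x) (g x) => [? ?] [? ?].
Qed.

Lemma cmeasurable_conj f : cmeasurable f -> cmeasurable (fun x => (f x)^*%R).
Proof.
move=> [fr fi]; split.
- rewrite (_ : (fun _ => _) = (fun x => complex.Re (f x)))//.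
  by apply/funext => x; case: (f x).
- rewrite (_ : (fun _ => _) = (fun x => - complex.Im (f x))).
    exact: measurable_funN.
  by apply/funext => x; case: (f x).
Qed.

Lemma cmeasurable_sum (I : Type) (s : seq I) (F : I -> borel G -> R[i]) :
  (forall i, cmeasurable (F i)) -> cmeasurable (fun x => \sum_(i <- s) F i x).
Proof.
move=> mF; elim: s => [|i s IHs].
  rewrite (_ : (fun _ => _) = (fun=> 0)); first exact: cmeasurable_cst.
  by apply/funext => x; rewrite big_nil.
rewrite (_ : (fun _ => _) = (fun x => F i x + \sum_(j <- s) F j x)).
  exact: cmeasurableD.
by apply/funext => x; rewrite big_cons.
Qed.

Lemma continuous_cmeasurable (f : G -> R[i]^o) : continuous f -> cmeasurable f.
Proof.
move=> cf; split; apply: continuous_borel_real => x.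
- apply/cvgrPdist_lt => e e0.
  have /cvgrPdist_lt /(_ e%:C) := cf x.
  rewrite ltcR => /(_ e0); apply: filterS => t /normc_geP[+ _].
  by case: (f x) (f t) => [? ?] [? ?].
- apply/cvgrPdist_lt => e e0.
  have /cvgrPdist_lt /(_ e%:C) := cf x.
  rewrite ltcR => /(_ e0); apply: filterS => t /normc_geP[_].
  by case: (f x) (f t) => [? ?] [? ?].
Qed.

Lemma measurable_mulg (g : G) :
  measurable_fun setT ((fun x : G => (x * g)%g) : borel G -> borel G).
Proof.
apply: continuous_borel => x.
apply: (@continuous_comp _ _ _ (fun x : G => (x, g)) (fun p : G * G => (p.1 * p.2)%g)).
  by apply: cvg_pair; [exact: cvg_id|exact: cvg_cst].
exact: mulg_continuous.
Qed.

Lemma haar_integralR (mu : probability (borel G) R) (g : G) (f : borel G -> R) :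
  is_haar mu -> measurable_fun setT f ->
  \int[mu]_(x in setT) f (((x : G) * g)%g : G) = \int[mu]_(x in setT) f x.
Proof.
move=> hmu mf; congr fine.
pose phi : borel G -> borel G := fun x : G => (x * g)%g.
have mphi : measurable_fun setT phi := measurable_mulg g.
have push (h : borel G -> \bar R) : measurable_fun setT h ->
    (forall x, (0 <= h x)%E) ->
    (\int[mu]_(x in setT) h (phi x) = \int[mu]_(x in setT) h x)%E.
  move=> mh h0.
  rewrite -[LHS](@ge0_integral_pushforward _ _ _ _ _ _ mphi mu setT h)//.
  apply: eq_measure_integral => A mA _; rewrite /pushforward.
  apply: etrans (haar_right hmu (g^-1)%g mA); congr (mu _).
  apply/seteqP; split => x /=.
    by move=> Ax; exists (phi x) => //; rewrite /phi mulgK.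
  by move=> [y Ay <-]; rewrite /phi mulgVK.
have mE : measurable_fun setT (EFin \o f) by exact: measurableT_comp.
rewrite integralE [RHS]integralE; congr (_ - _)%E.
- apply: etrans (push (EFin \o f)^\+%E (measurable_funepos mE) (funepos_ge0 _)).
  by apply: eq_integral => x _; rewrite !funeposE.
- apply: etrans (push (EFin \o f)^\-%E (measurable_funeneg mE) (funeneg_ge0 _)).
  by apply: eq_integral => x _; rewrite !funenegE.
Qed.

Lemma haar_cintegralR (mu : probability (borel G) R) (g : G)
    (f : borel G -> R[i]) :
  is_haar mu -> cmeasurable f ->
  cintegral mu (fun x : borel G => f ((x : G) * g)%g) = cintegral mu f.
Proof.
move=> hmu [mr mi]; apply: (f_equal2 (@Complex R)).
- exact: (haar_integralR g hmu mr).
- exact: (haar_integralR g hmu mi).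
Qed.

End BorelMeasurability.

Lemma mx_entry_continuous (T : topologicalType) m n (i : 'I_m) (j : 'I_n) :
  continuous (fun M : 'M[T]_(m, n) => M i j).
Proof.
move=> M A MA; exists (fun k l => [set x | k = i -> l = j -> A x]).
  move=> k l; have [[-> ->]|kl] := pselect (k = i /\ l = j).
    by apply: filterS MA => x Ax.
  by apply: filterS filterT => x _ ki lj; case: kl.
by move=> N /(_ i j); exact.
Qed.

Section OrbitAverageE.
Context (R : realType) (G : topGroupType) (n : nat)
  (mu : probability (borel G) R) (U : G -> 'M[R[i]]_n)
  (mu_haar : is_haar mu) (U_rep : unitary_rep U).

Lemma rep_entry_cmeasurable i j : cmeasurable (fun g => U g i j).
Proof.
apply: continuous_cmeasurable => g.
rewrite (_ : (fun h => U h i j) = fun h : G => (U h *m delta_mx j 0 : 'cV_n) i 0).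
  apply: (@continuous_comp _ _ _ (fun h : G => U h *m delta_mx j 0 : 'cV[R[i]^o]_n)
    (fun M : 'cV[R[i]^o]_n => M i 0) g).
    exact: (@rep_continuous _ _ _ _ U_rep (delta_mx j 0) g).
  exact: mx_entry_continuous.
by apply/funext => h; rewrite -colE mxE.
Qed.

Lemma rep_conj_cmeasurable (r : 'M[R[i]]_n) i j :
  cmeasurable (fun g => (U g *m r *m (U g)^t*) i j).
Proof.
rewrite (_ : (fun _ => _) = fun g => \sum_k (\sum_l U g i l * r l k) * (U g j k)^*).
  apply: cmeasurable_sum => k; apply: cmeasurableM.
    apply: cmeasurable_sum => l; apply: cmeasurableM.
      exact: rep_entry_cmeasurable.
    exact: cmeasurable_cst.
  exact/cmeasurable_conj/rep_entry_cmeasurable.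
by apply/funext => g; rewrite !mxE; apply: eq_bigr => k _; rewrite !mxE.
Qed.

Lemma twirl_rep (g : G) (r : 'M[R[i]]_n) :
  twirl mu U (U g *m r *m (U g)^t*) = twirl mu U r.
Proof.
rewrite /twirl; apply/matrixP => i j; rewrite [LHS]mxE [RHS]mxE.
have E (x : G) : U x *m (U g *m r *m (U g)^t*) *m (U x)^t* =
    U (x * g)%g *m r *m (U (x * g)%g)^t*.
  by rewrite (repM U_rep) trmx_mul map_mxM /= !mulmxA.
pose F (x : borel G) : R[i] := (U x *m r *m (U x)^t*) i j.
transitivity (cintegral mu (fun x : borel G => F ((x : G) * g)%g)).
  by congr (cintegral mu _); apply/funext => x; rewrite E.
exact: (haar_cintegralR g mu_haar (rep_conj_cmeasurable r i j)).
Qed.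

Lemma orbit_avgE d (Theta : measurableType d) (act : G -> Theta -> Theta)
    (rho : Theta -> 'M[R[i]]_n) (t : Theta) :
  measurable_action act ->
  (forall g t, rho (act g t) = U g *m rho t *m (U g)^t*) ->
  orbit_avg mu U rho (orbit_map act t) = twirl mu U (rho t).
Proof.
move=> aact cov; rewrite /orbit_avg.
have : orbit_map act (orbit_repr (orbit_map act t)) = orbit_map act t.
  exact: orbit_reprK.
move=> /(congr1 sval) /= E.
have : orbit act t (orbit_repr (orbit_map act t)).
  by rewrite -E; exists 1%g => //; rewrite (act1 aact).
by move=> [g _ <-]; rewrite cov twirl_rep.
Qed.

End OrbitAverageE.

Section POVM.
Context (R : realType) (n : nat).

Record povm d (Y : measurableType d) := Povm {
  povm_op :> set Y -> 'M[R[i]]_n ;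
  povm_positive : forall B, measurable B -> positive_op (povm_op B) ;
  povm_additive : forall F : (set Y)^nat, (forall k, measurable (F k)) ->
    trivIset setT F -> forall u v : 'cV[R[i]]_n,
    (fun k => \sum_(i < k) inner u (povm_op (F i) *m v) : R[i]^o) @ \oo -->
      (inner u (povm_op (\bigcup_k F k) *m v) : R[i]^o) ;
  povm_total : povm_op setT = 1%:M
}.

Definition law (s : 'M[R[i]]_n) d (Y : measurableType d) (M : povm Y)
    (B : set Y) : \bar R := (born s (M B))%:E.

Definition standard_borel d (Y : measurableType d) : Prop :=
  exists (T : completePseudoMetricType R) (f : Y -> T),
    [/\ hausdorff_space T,
        exists D : set T, countable D /\ dense D,
        bijective f
      & forall A : set Y,
          measurable A <-> measurable (f @` A : set (borel T))].

Definition povm_class := forall d (Y : measurableType d), povm Y -> Prop.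

Definition invariant_povms (G : topGroupType) (U : G -> 'M[R[i]]_n) :
    povm_class :=
  fun d Y M => standard_borel Y /\
    forall g B, measurable B -> (U g)^t* *m M B *m U g = M B.

Definition qc_sufficient (I : Type) (Q : I -> 'M[R[i]]_n) (C : povm_class)
    d (X : measurableType d) (M : povm X) : Prop :=
  C d X M /\
  forall d' (Y : measurableType d') (N : povm Y), C d' Y N ->
    exists K : R.-pker X ~> Y, forall (eta : I) (B : set Y), measurable B ->
      law (Q eta) N B = (\int[law (Q eta) M]_(x in setT) K x B)%E.

End POVM.
Arguments povm R n {d} Y.

(* Z with all subsets measurable; z0 is the base point the library demands. *)
Definition discrete (Z : Type) (z0 : Z) : Type := Z.

Section Discrete.
Context (Z : finType) (z0 : Z).
HB.instance Definition _ := Finite.on (discrete z0).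
HB.instance Definition _ := isPointed.Build (discrete z0) z0.
HB.instance Definition _ := @isMeasurable.Build default_measure_display
  (discrete z0) discrete_measurable discrete_measurable0
  discrete_measurableC discrete_measurableU.
End Discrete.

(* Main.v *)
Require Import Defs.
From HB Require Import structures.
From mathcomp Require Import all_boot all_order all_algebra.
From mathcomp Require Import spectral sesquilinear.
From mathcomp Require Import complex.
From mathcomp Require Import all_classical all_reals all_analysis.
From mathcomp Require Import ring measurable_realfun.

(* By identifiability the vectors p_eta span R^Z, so that finitely many eta_j
   and coefficients c z j satisfy sum_j c z j * p_(eta_j)(w) = [z = w]; put
   tau_z := sum_j c z j * rhobar_(eta_j). For an invariant effect E, sufficiency
   applied to the two-outcome measurement {E, 1 - E} gives k >= 0 on Z with
   tr(rhobar_eta E) = sum_z p_eta(z) k(z) for all eta, hence tr(tau_z E) = k(z).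
   Taking for E the group average of the projection on a unit vector v, which
   has the same pairing with rhobar_eta as the projection itself, yields
   <v, tau_z v> = k(z) >= 0 and <v, rhobar_eta v> = sum_z p_eta(z) <v, tau_z v>.
   The block structure of tau_z follows from tr(tau_z Pi_w) = [z = w]. *)

Set Implicit Arguments.
Unset Strict Implicit.
Unset Printing Implicit Defensive.

Import Order.TTheory GRing.Theory Num.Theory.
Import numFieldNormedType.Exports.

Local Open Scope classical_set_scope.
Local Open Scope ring_scope.
Local Open Scope complex_scope.
Local Open Scope sesquilinear_scope.

(** * Inner products, positive operators and orthogonal projections *)

Section Inner.
Context (R : realType) (n : nat).
Local Notation C := R[i].
Implicit Types (u v w : 'cV[C]_n) (A P : 'M[C]_n).

Lemma innerDl u v w : inner (u + v) w = inner u w + inner v w.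
Proof. by rewrite /inner linearD map_mxD mulmxDl mxE. Qed.

Lemma innerDr u v w : inner u (v + w) = inner u v + inner u w.
Proof. by rewrite /inner mulmxDr mxE. Qed.

Lemma innerZl c u v : inner (c *: u) v = c^*%R * inner u v.
Proof. by rewrite /inner linearZ map_mxZ -scalemxAl mxE. Qed.

Lemma innerZr c u v : inner u (c *: v) = c * inner u v.
Proof. by rewrite /inner -scalemxAr mxE. Qed.

Lemma innerNr u v : inner u (- v) = - inner u v.
Proof. by rewrite /inner mulmxN mxE. Qed.

Lemma innerBr u v w : inner u (v - w) = inner u v - inner u w.
Proof. by rewrite innerDr innerNr. Qed.

Lemma inner_sumr (I : Type) (s : seq I) (F : I -> 'cV[C]_n) u :
  inner u (\sum_(i <- s) F i) = \sum_(i <- s) inner u (F i).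
Proof. by rewrite /inner mulmx_sumr summxE. Qed.

Lemma inner_conj u v : (inner u v)^*%R = inner v u.
Proof.
rewrite /inner !mxE rmorph_sum; apply: eq_bigr => i _.
by rewrite !mxE rmorphM /= conjCK mulrC.
Qed.

Lemma inner_mulmxl A u v : inner (A *m u) v = inner u (A^t* *m v).
Proof. by rewrite /inner trmx_mul map_mxM mulmxA. Qed.

Lemma inner_mulmx_tr A u v : inner u (A *m v) = \tr (A *m (v *m u^t*)).
Proof. by rewrite /inner -trace_mx11 mxtrace_mulC mulmxA. Qed.

Lemma inner_delta A i j : inner (delta_mx i 0) (A *m delta_mx j 0) = A i j.
Proof.
rewrite inner_mulmx_tr trmx_delta map_delta_mx mul_delta_mx mxtrace_mulC.
rewrite /mxtrace (bigD1 j)//= big1 ?addr0 => [|k kj].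
  rewrite mxE (bigD1 i)//= big1 ?addr0 => [|l li].
    by rewrite mxE !eqxx mul1r.
  by rewrite mxE (negbTE li) andbF mul0r.
by rewrite mxE big1// => l _; rewrite mxE (negbTE kj) mul0r.
Qed.

Lemma inner_ge0 v : 0 <= inner v v.
Proof.
rewrite /inner mxE sumr_ge0// => i _.
by rewrite !mxE mulrC mul_conjC_ge0.
Qed.

Lemma inner_eq0 v : (inner v v == 0) = (v == 0).
Proof.
apply/eqP/eqP => [|->]; last by rewrite /inner mulmx0 mxE.
rewrite /inner mxE => /eqP; rewrite psumr_eq0 => [|i _]; last first.
  by rewrite !mxE mulrC mul_conjC_ge0.
move=> /allP v0; apply/matrixP => i j; rewrite ord1 mxE.
have /(_ (mem_index_enum _)) := v0 i.
by rewrite /= !mxE mulrC mul_conjC_eq0 => /eqP.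
Qed.

Lemma inner_mulmx_eq0 A : (forall u v, inner u (A *m v) = 0) -> A = 0.
Proof. by move=> A0; apply/matrixP => i j; rewrite -inner_delta A0 mxE. Qed.

(* Complex polarization: it would fail over the reals. *)
Lemma quadratic_form_eq0 A : (forall v, inner v (A *m v) = 0) -> A = 0.
Proof.
move=> A0; apply: inner_mulmx_eq0 => u v.
have pol c : c * inner u (A *m v) + c^*%R * inner v (A *m u) = 0.
  have := A0 (u + c *: v).
  rewrite mulmxDr -scalemxAr innerDl !innerDr !innerZl !innerZr !A0.
  by rewrite !mulr0 add0r addr0.
have := pol 1; have := pol 'i; rewrite conjC1 conjCi !mul1r mulNr -mulrBr.
move=> /eqP; rewrite mulf_eq0 (negbTE (neq0Ci _)) /= subr_eq0 => /eqP <-.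
by move/eqP; rewrite -mulr2n mulrn_eq0 => /eqP.
Qed.

(** The values [inner v (A *m v)] are real, so the quadratic form of [A^t* - A] vanishes, and over
    the complex numbers this determines the operator. *)
Lemma positive_op_herm A : positive_op A -> A^t* = A.
Proof.
move=> A0; apply/eqP; rewrite -subr_eq0; apply/eqP; apply: quadratic_form_eq0.
move=> v; rewrite mulmxBl innerBr -inner_mulmxl -inner_conj.
by apply/eqP; rewrite subr_eq0; apply/eqP/CrealP/ger0_real/A0.
Qed.

Lemma positive_op_ker A u :
  positive_op A -> inner u (A *m u) = 0 -> A *m u = 0.
Proof.
move=> A0 u0; apply/eqP; rewrite -inner_eq0; apply/negPn/negP => x0.
set x := A *m u in u0 x0.
have xpos : 0 < inner x x by rewrite lt_def x0 inner_ge0.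
have a0 := A0 x; set a := inner x (A *m x) in a0.
(* With [x = A *m u] and [inner u x = 0], the form of [A] at [x - t *: u] is
   [a - 2 * t * inner x x]. This [t] makes it [- a - 2], which is negative and contradicts
   positivity. *)
pose t := (a + 1) / inner x x.
have t0 : 0 <= t := divr_ge0 (addr_ge0 a0 ler01) (ltW xpos).
have := A0 (x - t *: u).
have -> : inner (x - t *: u) (A *m (x - t *: u)) = - a - 2.
  rewrite -scaleNr mulmxDr -scalemxAr innerDl !innerDr !innerZl !innerZr.
  rewrite -/x u0 !mulr0 addr0 rmorphN /= geC0_conj//.
  have -> : inner u (A *m x) = inner x x.
    by rewrite -{1}(positive_op_herm A0) -inner_mulmxl.
  rewrite -/a /t !mulNr divfK//; ring.
by rewrite -opprD oppr_ge0 lt_geF// ltr_wpDl.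
Qed.

Lemma orth_proj_id P V v : orth_proj P V -> v \in V -> P *m v = v.
Proof.
move=> PV vV; have [Pv orth] := PV v.
apply/eqP; rewrite eq_sym -subr_eq0 -inner_eq0; apply/eqP/orth.
exact: rpredB.
Qed.

(** Since [v - P *m v] is orthogonal to the range of [P], one has [P^t* *m (1%:M - P) = 0]. Hence
    [P^t* = P^t* *m P], and the right side is self-adjoint. *)
Lemma orth_proj_herm P V : orth_proj P V -> P^t* = P.
Proof.
move=> PV; have E : P^t* *m (1%:M - P) = 0.
  apply: inner_mulmx_eq0 => u v.
  rewrite -mulmxA -inner_mulmxl mulmxBl mul1mx.
  by apply: (PV v).2; exact: (PV u).1.
have {}E : P^t* = P^t* *m P.
  by apply/eqP; rewrite -subr_eq0 -{1}(mulmx1 (P^t*)) -mulmxBr E.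
by rewrite -[in RHS](trmxCK P) E trmx_mul map_mxM !trmxCK -E.
Qed.

Lemma orth_proj_idem P V : orth_proj P V -> P *m P = P.
Proof.
move=> PV; apply/eqP; rewrite -subr_eq0; apply/eqP.
apply: inner_mulmx_eq0 => u v; rewrite mulmxBl -mulmxA.
by rewrite (orth_proj_id PV (PV v).1) subrr /inner mulmx0 mxE.
Qed.

(** Exhibits the sandwiched trace as a sum of values of the quadratic form of [A]; the sign and the
    vanishing of [\tr (A *m P)] are read off from it below. *)
Lemma mxtrace_conj_inner A P :
  \tr (P^t* *m A *m P) =
  \sum_i inner (P *m delta_mx i 0) (A *m (P *m delta_mx i 0)).
Proof.
rewrite /mxtrace; apply: eq_bigr => i _.
by rewrite -inner_delta inner_mulmxl !mulmxA.
Qed.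

Lemma mxtrace_orth_proj A P V :
  orth_proj P V -> \tr (A *m P) = \tr (P^t* *m A *m P).
Proof.
move=> PV; rewrite (orth_proj_herm PV) -[in RHS]mulmxA [RHS]mxtrace_mulC.
by rewrite -mulmxA (orth_proj_idem PV).
Qed.

Lemma mxtrace_positive_proj_ge0 A P V :
  positive_op A -> orth_proj P V -> 0 <= \tr (A *m P).
Proof.
move=> A0 PV.
by rewrite (mxtrace_orth_proj _ PV) mxtrace_conj_inner sumr_ge0.
Qed.

(** A vanishing sum of nonnegative terms vanishes termwise, and [positive_op_ker] then kills each
    column of [A *m P]. *)
Lemma mxtrace_positive_proj_eq0 A P V :
  positive_op A -> orth_proj P V -> \tr (A *m P) = 0 -> A *m P = 0.
Proof.
move=> A0 PV.
rewrite (mxtrace_orth_proj _ PV) mxtrace_conj_inner => /eqP; rewrite psumr_eq0// => /allP AP0.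
apply/matrixP => i j; rewrite -inner_delta -mulmxA.
have /(_ (mem_index_enum _)) /eqP := AP0 j.
by move=> /(positive_op_ker A0) ->; rewrite /inner mulmx0 !mxE.
Qed.

Lemma sum_orth_proj (Z : finType) (H : Z -> {vspace 'cV[C]_n})
    (Pi : Z -> 'M[C]_n) :
  orth_decomposition H -> (forall z, orth_proj (Pi z) (H z)) ->
  \sum_z Pi z = 1%:M.
Proof.
move=> [_ orth HT] PiH; apply/eqP; rewrite -subr_eq0; apply/eqP.
apply: inner_mulmx_eq0 => u v.
suff -> : (\sum_z Pi z - 1%:M) *m v = 0 by rewrite /inner mulmx0 mxE.
have : v \in (\sum_z H z)%VS by rewrite HT memvf.
move=> /memv_sumP[vs vsH ->]; rewrite mulmxBl mul1mx mulmx_suml.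
apply/eqP; rewrite subr_eq0; apply/eqP; apply: eq_bigr => z _.
rewrite mulmx_sumr (bigD1 z)//= big1 ?addr0 => [|w wz].
  by rewrite (orth_proj_id (PiH z))// vsH.
(* The vector [Pi z *m vs w] lies in [H z], so it is orthogonal both to [vs w] and to
   [vs w - Pi z *m vs w], hence to itself. *)
have [Pv o] := PiH z (vs w); have := o _ Pv.
rewrite innerBr (orth z w) ?vsH// 1?eq_sym// sub0r => /eqP.
by rewrite oppr_eq0 inner_eq0 => /eqP.
Qed.

(** By homogeneity. Unit vectors are singled out because [v *m v^t*] is then an effect, that is,
    lies between 0 and the identity. *)
Lemma inner_unit_ge0_positive A :
  (forall v, inner v v = 1 -> 0 <= inner v (A *m v)) -> positive_op A.
Proof.
move=> A0 v; have [->|v0] := eqVneq v 0; first by rewrite mulmx0 /inner mulmx0 mxE.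
have vpos : 0 < inner v v by rewrite lt_def inner_eq0 v0 inner_ge0.
pose s := sqrtC (inner v v).
have spos : 0 < s by rewrite sqrtC_gt0.
have /A0 : inner (s^-1 *: v) (s^-1 *: v) = 1.
  rewrite innerZl innerZr geC0_conj ?invr_ge0 ?ltW// mulrA -expr2 exprVn sqrtCK.
  by rewrite mulVf// gt_eqF.
rewrite -scalemxAr innerZl innerZr. 
have si : 0 <= s^-1 by rewrite invr_ge0 ltW.
rewrite geC0_conj// mulrA.
by rewrite pmulr_rge0// mulr_gt0 ?invr_gt0.
Qed.

Lemma rank1_positive v : positive_op (v *m v^t*).
Proof.
move=> w; rewrite -mulmxA [v^t* *m w]mx11_scalar mul_mx_scalar innerZr.
by rewrite -/(inner v w) -(inner_conj v w) mul_conjC_ge0.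
Qed.

(** [Q] is a self-adjoint idempotent, so its form at [w] is the squared norm of [Q *m w]. *)
Lemma rank1_compl_positive v :
  inner v v = 1 -> positive_op (1%:M - v *m v^t*).
Proof.
move=> v1 w; set Q := 1%:M - _.
have Qh : Q^t* = Q.
  rewrite /Q linearB /= map_mxB trmx1 map_mx1 trmx_mul map_mxM trmxCK.
  by [].
have v11 : v^t* *m v = 1%:M by rewrite [LHS]mx11_scalar -/(inner v v) v1.
have QQ : Q *m Q = Q.
  rewrite {2}/Q mulmxBr mulmx1 mulmxA {2}/Q mulmxBl mul1mx -mulmxA v11 mulmx1.
  by rewrite subrr mul0mx subr0.
by rewrite -QQ -mulmxA -{1}Qh -inner_mulmxl inner_ge0.
Qed.

End Inner.

(** * Integration of bounded complex functions on the group *)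

Section ComplexIntegral.
Context (R : realType) (G : topGroupType) (mu : probability (borel G) R).
Local Notation C := R[i].
Implicit Types f g : borel G -> C.

(** A class that is stable under sums, products and conjugation, contains the matrix coefficients of
    a unitary representation, and makes integrability against a probability measure automatic. *)
Definition bounded_cmeasurable f : Prop :=
  cmeasurable f /\ exists M : R, forall x, `|f x| <= M%:C.

Lemma bounded_cmeasurable_cst c : bounded_cmeasurable (fun=> c).
Proof.
split; first exact: cmeasurable_cst.
by eexists => _; rewrite normc_def.
Qed.

Lemma bounded_cmeasurableD f g : bounded_cmeasurable f ->
  bounded_cmeasurable g -> bounded_cmeasurable (fun x => f x + g x).
Proof.
move=> [mf [M fM]] [mg [N gN]]; split; first exact: cmeasurableD.
exists (M + N) => x; rewrite rmorphD; apply: le_trans (ler_normD _ _) _.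
exact: lerD.
Qed.

Lemma bounded_cmeasurableM f g : bounded_cmeasurable f ->
  bounded_cmeasurable g -> bounded_cmeasurable (fun x => f x * g x).
Proof.
move=> [mf [M fM]] [mg [N gN]]; split; first exact: cmeasurableM.
by exists (M * N) => x; rewrite rmorphM normrM ler_pM.
Qed.

Lemma bounded_cmeasurable_conj f : bounded_cmeasurable f ->
  bounded_cmeasurable (fun x => (f x)^*%R).
Proof.
move=> [mf [M fM]]; split; first exact: cmeasurable_conj.
by exists M => x; rewrite norm_conjC.
Qed.

Lemma bounded_cmeasurable_sum (I : Type) (s : seq I) (F : I -> borel G -> C) :
  (forall i, bounded_cmeasurable (F i)) ->
  bounded_cmeasurable (fun x => \sum_(i <- s) F i x).
Proof.
move=> bF; elim: s => [|i s IHs].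
  rewrite (_ : (fun _ => _) = fun=> 0); first exact: bounded_cmeasurable_cst.
  by apply/funext => x; rewrite big_nil.
rewrite (_ : (fun _ => _) = (fun x => F i x + \sum_(j <- s) F j x)).
  exact: bounded_cmeasurableD.
by apply/funext => x; rewrite big_cons.
Qed.

Let bounded_integrable (h : borel G -> R) (M : R) :
  measurable_fun setT h -> (forall x, `|h x| <= M) ->
  mu.-integrable setT (EFin \o h).
Proof.
move=> mh hM; apply: measurable_bounded_integrable => //.
  exact: le_lt_trans (probability_le1 mu measurableT) (ltry _).
exists M; split; first exact: num_real.
by move=> N MN x _ /=; apply: le_trans (hM x) (ltW MN).
Qed.

Lemma bounded_cmeasurable_integrable f : bounded_cmeasurable f ->
  mu.-integrable setT (EFin \o (fun x => complex.Re (f x))) /\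
  mu.-integrable setT (EFin \o (fun x => complex.Im (f x))).
Proof.
move=> [[mr mi] [M fM]]; split; apply: (bounded_integrable (M := M)) => // x.
- by rewrite -lecR; apply: le_trans (fM x); exact: normc_ge_Re.
- rewrite -lecR; apply: le_trans (fM x).
  case: (f x) => a b /=; rewrite normc_def lecR /= -sqrtr_sqr.
  by rewrite ler_wsqrtr// lerDr sqr_ge0.
Qed.

Lemma cintegralD f g : bounded_cmeasurable f -> bounded_cmeasurable g ->
  cintegral mu (fun x => f x + g x) = cintegral mu f + cintegral mu g.
Proof.
move=> /bounded_cmeasurable_integrable[fr fi].
move=> /bounded_cmeasurable_integrable[gr gi].
rewrite /cintegral [RHS]/GRing.add /=; congr (_ +i* _).
- rewrite -RintegralD//; congr (fine _); apply: eq_integral => x _.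
  by case: (f x) (g x) => [? ?] [? ?].
- rewrite -RintegralD//; congr (fine _); apply: eq_integral => x _.
  by case: (f x) (g x) => [? ?] [? ?].
Qed.

Lemma cintegralZ c f : bounded_cmeasurable f ->
  cintegral mu (fun x => c * f x) = c * cintegral mu f.
Proof.
move=> /bounded_cmeasurable_integrable[fr fi]; case: c => a b.
have int (h : borel G -> R) r : mu.-integrable setT (EFin \o h) ->
    mu.-integrable setT (EFin \o (fun x => r * h x)).
  by move=> ih; apply: eq_integrable (integrableZl measurableT r ih).
rewrite /cintegral [RHS]/GRing.mul /=; congr (_ +i* _).
- rewrite -!RintegralZl// -RintegralB//; [|exact: int|exact: int].
  by congr (fine _); apply: eq_integral => x _; case: (f x).
- rewrite -!RintegralZl// -RintegralD//; [|exact: int|exact: int].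
  by congr (fine _); apply: eq_integral => x _; case: (f x).
Qed.

Lemma cintegral_cst c : cintegral mu (fun=> c) = c.
Proof.
have E (r : R) : \int[mu]_(_ in setT) r = r.
  apply: etrans (Rintegral_cst mu measurableT r) _.
  apply: etrans (congr1 (fun t => r * fine t) (@probability_setT _ _ _ mu)) _.
  by rewrite mulr1.
by rewrite /cintegral !E; case: c.
Qed.

Lemma cintegral_sum (I : Type) (s : seq I) (F : I -> borel G -> C) :
  (forall i, bounded_cmeasurable (F i)) ->
  cintegral mu (fun x => \sum_(i <- s) F i x) =
  \sum_(i <- s) cintegral mu (F i).
Proof.
move=> bF; elim: s => [|i s IHs].
  rewrite big_nil -[RHS]cintegral_cst; congr (cintegral mu _).
  by apply/funext => x; rewrite big_nil.
rewrite big_cons -IHs -cintegralD//; last exact: bounded_cmeasurable_sum.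
by congr (cintegral mu _); apply/funext => x; rewrite big_cons.
Qed.

Lemma cintegral_ge0 f : (forall x, 0 <= f x) -> 0 <= cintegral mu f.
Proof.
move=> f0; rewrite lecE /cintegral /=; apply/andP; split.
  rewrite (_ : (fun x => _) = (fun=> 0)).
    by rewrite Rintegral_cst// mul0r.
  by apply/funext => x; have := f0 x; rewrite lecE => /andP[/eqP].
apply: Rintegral_ge0 => x _.
by have := f0 x; rewrite lecE => /andP[].
Qed.

End ComplexIntegral.

(** * Entrywise integration of matrix-valued functions *)

Section MatrixIntegral.
Context (R : realType) (G : topGroupType) (mu : probability (borel G) R).
Context (n : nat).
Local Notation C := R[i].
Implicit Types (F : borel G -> 'M[C]_n) (A r : 'M[C]_n).

Definition mxintegral F : 'M[C]_n := \matrix_(i, j) cintegral mu (fun x => F x i j).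

Definition bounded_mxmeasurable F : Prop :=
  forall i j, bounded_cmeasurable (fun x => F x i j).

Lemma bounded_mxmeasurable_cst A : bounded_mxmeasurable (fun=> A).
Proof. by move=> i j; exact: bounded_cmeasurable_cst. Qed.

Lemma bounded_mxmeasurableM F F' : bounded_mxmeasurable F ->
  bounded_mxmeasurable F' -> bounded_mxmeasurable (fun x => F x *m F' x).
Proof.
move=> bF bF' i j; rewrite (_ : (fun _ => _) = fun x => \sum_k F x i k * F' x k j).
  by apply: bounded_cmeasurable_sum => k; exact: bounded_cmeasurableM.
by apply/funext => x; rewrite mxE.
Qed.

Lemma bounded_mxmeasurable_trmxC F :
  bounded_mxmeasurable F -> bounded_mxmeasurable (fun x => (F x)^t*).
Proof.
move=> bF i j; rewrite (_ : (fun _ => _) = fun x => (F x j i)^*%R).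
  exact: bounded_cmeasurable_conj.
by apply/funext => x; rewrite !mxE.
Qed.

Lemma mxtrace_mxintegral A F : bounded_mxmeasurable F ->
  \tr (A *m mxintegral F) = cintegral mu (fun x => \tr (A *m F x)).
Proof.
move=> bF; transitivity
    (cintegral mu (fun x => \sum_i \sum_j A i j * F x j i)); last first.
  congr (cintegral mu _); apply/funext => x; apply: eq_bigr => i _.
  by rewrite mxE.
have bAF i j : bounded_cmeasurable (fun x => A i j * F x j i).
  by apply: bounded_cmeasurableM => //; exact: bounded_cmeasurable_cst.
rewrite cintegral_sum => [|i]; last exact: bounded_cmeasurable_sum.
apply: eq_bigr => i _; rewrite mxE cintegral_sum//.
by apply: eq_bigr => j _; rewrite mxE cintegralZ.
Qed.

Lemma inner_mxintegral (u v : 'cV[C]_n) F : bounded_mxmeasurable F ->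
  inner u (mxintegral F *m v) = cintegral mu (fun x => inner u (F x *m v)).
Proof.
move=> bF; rewrite inner_mulmx_tr mxtrace_mulC mxtrace_mxintegral//.
congr (cintegral mu _); apply/funext => x.
by rewrite [RHS]inner_mulmx_tr mxtrace_mulC.
Qed.

Lemma mulmx_mxintegral A r F : bounded_mxmeasurable F ->
  A *m mxintegral F *m r = mxintegral (fun x => A *m F x *m r).
Proof.
move=> bF; apply/matrixP => i j; rewrite [RHS]mxE -inner_delta -!mulmxA.
rewrite -{1}(trmxCK A) -inner_mulmxl inner_mxintegral//.
congr (cintegral mu _); apply/funext => x.
by rewrite -[in RHS]inner_delta inner_mulmxl trmxCK !mulmxA.
Qed.

Lemma mxintegralB F F' : bounded_mxmeasurable F -> bounded_mxmeasurable F' ->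
  mxintegral (fun x => F x - F' x) = mxintegral F - mxintegral F'.
Proof.
move=> bF bF'; apply/matrixP => i j; rewrite !mxE -mulN1r -cintegralZ//.
rewrite -cintegralD//; last first.
  by apply: bounded_cmeasurableM => //; exact: bounded_cmeasurable_cst.
by congr (cintegral mu _); apply/funext => x; rewrite !mxE mulN1r.
Qed.

Lemma mxintegral_cst A : mxintegral (fun=> A) = A.
Proof. by apply/matrixP => i j; rewrite mxE cintegral_cst. Qed.

Lemma mxintegral_positive F : bounded_mxmeasurable F ->
  (forall x, positive_op (F x)) -> positive_op (mxintegral F).
Proof.
by move=> bF F0 v; rewrite inner_mxintegral//; apply: cintegral_ge0 => x; exact: F0.
Qed.

End MatrixIntegral.

(** * Averaging states and effects over the group *)

Lemma positive_op_conj (R : realType) (n : nat) (A B : 'M[R[i]]_n) :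
  positive_op A -> positive_op (B^t* *m A *m B).
Proof. by move=> A0 v; rewrite -!mulmxA -inner_mulmxl. Qed.

Lemma mxtrace_cycle4 (R : comPzRingType) (n : nat) (A B C D : 'M[R]_n) :
  \tr (A *m (B *m C *m D)) = \tr (C *m (D *m A *m B)).
Proof. by rewrite mxtrace_mulC -!mulmxA mxtrace_mulC -!mulmxA. Qed.

Section Twirl.
Context (R : realType) (G : topGroupType) (n : nat)
  (mu : probability (borel G) R) (U : G -> 'M[R[i]]_n)
  (mu_haar : is_haar mu) (U_rep : unitary_rep U).
Implicit Types (A r : 'M[R[i]]_n).

Lemma unitary_trmxCl g : (U g)^t* *m U g = 1%:M.
Proof. by apply: mulmx1C; apply/unitarymxP; exact: (rep_unitary U_rep). Qed.

(** Rows of a unitary matrix have norm one, so every entry has modulus at most 1. *)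
Lemma rep_bounded_mxmeasurable : bounded_mxmeasurable (U : borel G -> _).
Proof.
move=> i j; split; first exact: rep_entry_cmeasurable.
exists 1 => g; have /unitarymxP := rep_unitary U_rep g.
move=> /matrixP/(_ i i); rewrite !mxE eqxx => E.
rewrite -(@expr_le1 _ 2)// normCK -[leRHS]E (bigD1 j)//= !mxE lerDl.
by apply: sumr_ge0 => k _; rewrite !mxE mul_conjC_ge0.
Qed.

Let bU := rep_bounded_mxmeasurable.

Lemma twirl_bounded_mxmeasurable r :
  bounded_mxmeasurable (fun g : borel G => U g *m r *m (U g)^t*).
Proof.
apply: bounded_mxmeasurableM; last exact: bounded_mxmeasurable_trmxC.
by apply: bounded_mxmeasurableM => //; exact: bounded_mxmeasurable_cst.
Qed.

(* The adjoint of [twirl] for the trace pairing. Right invariance of the Haar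
   measure alone makes its values invariant. *)
Definition cotwirl A : 'M[R[i]]_n :=
  mxintegral mu (fun g : borel G => (U g)^t* *m A *m U g).

Lemma cotwirl_bounded_mxmeasurable A :
  bounded_mxmeasurable (fun g : borel G => (U g)^t* *m A *m U g).
Proof.
apply: bounded_mxmeasurableM => //; apply: bounded_mxmeasurableM.
  exact: bounded_mxmeasurable_trmxC.
exact: bounded_mxmeasurable_cst.
Qed.

Lemma cotwirl_invariant A h : (U h)^t* *m cotwirl A *m U h = cotwirl A.
Proof.
rewrite mulmx_mxintegral; last exact: cotwirl_bounded_mxmeasurable.
apply/matrixP => i j; rewrite [LHS]mxE [RHS]mxE.
pose f (g : borel G) : R[i] := ((U g)^t* *m A *m U g) i j.
have mf : cmeasurable f := (cotwirl_bounded_mxmeasurable A i j).1.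
(* Conjugation by [U h] turns the integrand at [g] into the integrand at the product of [g] and
   [h]. *)
apply: etrans (haar_cintegralR h mu_haar mf); congr (cintegral mu _).
by apply/funext => g; rewrite /f (repM U_rep) trmx_mul map_mxM !mulmxA.
Qed.

Lemma cotwirlB1 A : cotwirl (1%:M - A) = 1%:M - cotwirl A.
Proof.
rewrite -[in RHS](mxintegral_cst mu 1%:M) /cotwirl -mxintegralB; first last.
- exact: cotwirl_bounded_mxmeasurable.
- exact: bounded_mxmeasurable_cst.
congr (mxintegral mu _); apply/funext => g.
by rewrite mulmxBr mulmx1 mulmxBl unitary_trmxCl.
Qed.

Lemma cotwirl_positive A : positive_op A -> positive_op (cotwirl A).
Proof.
move=> A0; apply: mxintegral_positive => [|g].
  exact: cotwirl_bounded_mxmeasurable.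
exact: positive_op_conj.
Qed.

Lemma twirl_positive r : positive_op r -> positive_op (twirl mu U r).
Proof.
move=> r0; apply: mxintegral_positive => [|g].
  exact: twirl_bounded_mxmeasurable.
by rewrite -{1}(trmxCK (U g)); exact: positive_op_conj.
Qed.

Lemma mxtrace_twirl r A :
  \tr (twirl mu U r *m A) = \tr (r *m cotwirl A).
Proof.
rewrite mxtrace_mulC mxtrace_mxintegral; last exact: twirl_bounded_mxmeasurable.
rewrite mxtrace_mxintegral; last exact: cotwirl_bounded_mxmeasurable.
congr (cintegral mu _); apply/funext => g.
exact: mxtrace_cycle4.
Qed.

(** An effect may be replaced by its invariant average without changing its statistics on averaged
    states. [cotwirl] is idempotent, because its values are invariant and [mu] has mass one; moving
    it across the trace pairing and back gives the claim. *)
Lemma mxtrace_twirl_cotwirl r A :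
  \tr (twirl mu U r *m cotwirl A) = \tr (twirl mu U r *m A).
Proof.
have E : cotwirl (cotwirl A) = cotwirl A.
  transitivity (mxintegral mu (fun=> cotwirl A)); last exact: mxintegral_cst.
  by congr (mxintegral mu _); apply/funext => g; exact: cotwirl_invariant.
apply: etrans (mxtrace_twirl r (cotwirl A)) _.
by apply: etrans (esym (mxtrace_twirl r A)); rewrite E.
Qed.

End Twirl.

(** * Two-outcome measurements *)

Section BinaryPOVM.
Context (R : realType) (n : nat).
Local Notation C := R[i].

(** At most one [F j] contains [x], so the partial sums are eventually constant. *)
Lemma cvg_sum_trivIset_mem (T : Type) (F : (set T)^nat) (x : T) :
  trivIset setT F ->
  (fun k => \sum_(i < k) (x \in F i)%:R : C^o) @ \oo -->
    ((x \in \bigcup_k F k)%:R : C^o).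
Proof.
move=> tF; apply: cvg_near_cst; have [xF|xF] := boolP (x \in \bigcup_k F k).
  move: xF; rewrite inE => -[j _ Fjx]; exists j.+1 => // k /= jk.
  rewrite (bigD1 (Ordinal jk))//= mem_set// big1 ?addr0// => i ij.
  case: (boolP (x \in F i)) => // /set_mem Fix.
  have ijE := tF i j Logic.I Logic.I (ex_intro _ x (conj Fix Fjx)).
  by move: ij; rewrite -val_eqE /= ijE eqxx.
exists 0%N => // k _ /=; rewrite big1// => i _.
by rewrite memNset// => Fix; move/negP: xF; apply; rewrite inE; exists (val i).
Qed.

Context (E : 'M[C]_n) (E_pos : positive_op E) (E_le1 : positive_op (1%:M - E)).

(** The two outcomes are the points 1 and 0 of the real line; taking the whole line as outcome space
    lets [standard_borel_R] supply the standard Borel condition. *)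
Definition binary_op (B : set (measurableTypeR R)) : 'M[C]_n :=
  ((1 : R) \in B)%:R *: E + ((0 : R) \in B)%:R *: (1%:M - E).

Lemma inner_binary_op (B : set R) (u v : 'cV[C]_n) : inner u (binary_op B *m v) =
  inner u (E *m v) * ((1 : R) \in B)%:R +
  inner u ((1%:M - E) *m v) * ((0 : R) \in B)%:R.
Proof.
rewrite [binary_op B]/binary_op [in LHS]mulmxDl [LHS]innerDr -!scalemxAl.
by rewrite !innerZr ![_%:R * _]mulrC.
Qed.

Lemma binary_op_positive B : measurable B -> positive_op (binary_op B).
Proof.
by move=> _ v; rewrite inner_binary_op addr_ge0// mulr_ge0// ?E_pos ?E_le1.
Qed.

Lemma binary_op_additive (F : (set (measurableTypeR R))^nat) :
  (forall k, measurable (F k)) -> trivIset setT F -> forall u v : 'cV[C]_n,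
  (fun k => \sum_(i < k) inner u (binary_op (F i) *m v) : C^o) @ \oo -->
    (inner u (binary_op (\bigcup_k F k) *m v) : C^o).
Proof.
move=> _ tF u v; rewrite inner_binary_op.
rewrite (_ : (fun k => _) = fun k =>
    inner u (E *m v) * \sum_(i < k) ((1 : R) \in F i)%:R +
    inner u ((1%:M - E) *m v) * \sum_(i < k) ((0 : R) \in F i)%:R).
  by apply: (@cvgD C C^o); apply: (@cvgM C); (exact: cvg_cst || exact: cvg_sum_trivIset_mem).
apply/funext => k; rewrite !mulr_sumr -big_split /=.
by apply: eq_bigr => i _; rewrite inner_binary_op.
Qed.

Lemma binary_op_total : binary_op setT = 1%:M.
Proof. by rewrite /binary_op !in_setT !scale1r addrC subrK. Qed.

Definition binary_povm : povm R n (measurableTypeR R) :=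
  Povm binary_op_positive binary_op_additive binary_op_total.

Lemma binary_povm1 : binary_povm [set (1 : R)] = E.
Proof.
rewrite /= /binary_op mem_set// memNset; last by move/esym/eqP; rewrite oner_eq0.
by rewrite scale1r scale0r addr0.
Qed.

End BinaryPOVM.

(** With the identity as the bijection, what remains is that two sigma-algebras agree: open sets are
    measurable in [measurableTypeR R], and the latter is generated by open intervals. *)
Lemma standard_borel_R (R : realType) : standard_borel R (measurableTypeR R).
Proof.
exists (R : completePseudoMetricType R), id; split.
- exact: norm_hausdorff.
- exists (range ratr); split; last exact: dense_rat.
  exact: card_le_trans (card_image_le _ _) (countableP _).
- by exists id.
- move=> A; rewrite image_id.
  split => [|]; last first.
    apply: smallest_sub; first exact: smallest_sigma_algebra.
    by move=> B oB; exact: open_measurable.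
  have -> : measurable A = (RGenOpens.G (R:=R)).-sigma.-measurable A.
    by rewrite -RGenOpens.measurableE.
  apply: sub_sigma_algebra2 => _ [x [y ->]]; exact: interval_open.
Qed.

(** * POVMs with finitely many outcomes *)

Lemma ReZ (R : rcfType) (a : R) (z : R[i]) :
  complex.Re (a%:C * z) = a * complex.Re z.
Proof. by case: z => x y /=; rewrite mul0r subr0. Qed.

Lemma born_sumZ (R : realType) n (s : 'M[R[i]]_n) (I : finType) (a : I -> R)
    (A : I -> 'M[R[i]]_n) :
  born s (\sum_i (a i)%:C *: A i) = \sum_i a i * born s (A i).
Proof.
have -> : born s (\sum_i (a i)%:C *: A i) =
    complex.Re (\sum_i (a i)%:C * \tr (s *m A i)).
  congr (complex.Re _); rewrite mulmx_sumr [LHS](linear_sum (@mxtrace _ n)).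
  by apply: eq_bigr => i _; rewrite /= -scalemxAr mxtraceZ.
by rewrite raddf_sum; apply: eq_bigr => i _; exact: ReZ.
Qed.

(** Additivity on the constant sequence of empty sets makes the multiples [c *+ k] converge; their
    successive differences equal [c] and tend to 0. *)
Lemma povm_set0 (R : realType) n d (Y : measurableType d) (N : povm R n Y) :
  N set0 = 0.
Proof.
apply: inner_mulmx_eq0 => u v; set c := inner _ _.
have t0 : trivIset setT (fun _ : nat => set0 : set Y) by move=> i j _ _ [x []].
have := @povm_additive _ _ _ _ N (fun=> set0) (fun=> measurable0) t0 u v.
rewrite bigcup0// -/c (_ : (fun k => _) = fun k : nat => c *+ k); last first.
  by apply/funext => k; rewrite sumr_const card_ord.
move=> cvc; have := cvc; rewrite -(cvg_shiftS (fun k : nat => c *+ k : R[i]^o)) => cvSc.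
have : (fun k : nat => c *+ k.+1 - c *+ k : R[i]^o) @ \oo --> (c - c : R[i]^o).
  exact: cvgB.
rewrite subrr (_ : (fun k : nat => _) = fun=> c).
  by move=> cv0; exact: (cvg_unique (@norm_hausdorff _ R[i]^o) (cvg_cst (c : R[i]^o)) cv0).
by apply/funext => k; rewrite mulrS addrK.
Qed.

Section DiscretePOVM.
Context (R : realType) (n : nat) (Z : finType) (z0 : Z)
  (M : povm R n (discrete z0)).
Local Notation C := R[i].

Lemma discrete_povmE (B : set Z) :
  M B = \sum_z (z \in B)%:R *: M [set z].
Proof.
apply/eqP; rewrite -subr_eq0; apply/eqP; apply: inner_mulmx_eq0 => u v.
apply/eqP; rewrite mulmxBl innerBr subr_eq0; apply/eqP.
pose e := index_enum Z.
have eM (z : Z) : z \in e by exact: mem_index_enum.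
(* Additivity is available for sequences only, so [B] is cut along the enumeration of [Z]: [F k] is
   the singleton of the [k]-th element if that lies in [B], and is empty otherwise, in particular
   for [k] past the end. *)
pose F k : set (discrete z0) :=
  [set z | [/\ (k < size e)%N, z = nth z0 e k & B z]].
have FB : \bigcup_k F k = B.
  apply/seteqP; split => [z [k _ []]//|z Bz].
  exists (index (z : Z) e) => //; split => //; first by rewrite index_mem eM.
  by rewrite nth_index ?eM.
have tF : trivIset setT F.
  move=> i j _ _ [z [[ie zi _] [je zj _]]]; apply/eqP.
  by rewrite -(nth_uniq z0 ie je (index_enum_uniq _)) -zi -zj.
have := @povm_additive _ _ _ _ M F (fun k => I) tF u v; rewrite FB => cvF.
apply: (cvg_unique (@norm_hausdorff _ C^o) cvF).
apply: cvg_near_cst; exists (size e) => // k /= ek.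
pose phi z := inner u ((z \in B)%:R *: M [set z] *m v).
have MF i : inner u (M (F i) *m v) = if (i < size e)%N then phi (nth z0 e i) else 0.
  case: ifPn => [ie|ie]; last first.
    rewrite (_ : F i = set0) ?povm_set0 ?mul0mx /inner ?mulmx0 ?mxE//.
    by apply/seteqP; split=> // z [ie']; rewrite ie' in ie.
  rewrite /phi; have [Bi|Bi] := boolP (nth z0 e i \in B).
    rewrite scale1r (_ : F i = [set nth z0 e i])//.
    apply/seteqP; split=> z; first by case.
    by move=> ->; split => //; exact: set_mem.
  rewrite scale0r (_ : F i = set0) ?povm_set0//.
  by apply/seteqP; split=> // z [_ -> /mem_set]; rewrite (negbTE Bi).
transitivity (\sum_(0 <= i < size e) phi (nth z0 e i)).
  rewrite -(big_mkord xpredT (fun i => inner u (M (F i) *m v))).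
  rewrite (big_cat_nat (n := size e))//= [X in _ + X = _]big_nat_cond [X in _ + X = _]big1.
    by rewrite addr0 big_nat [RHS]big_nat; apply: eq_bigr => i /andP[_ ie]; rewrite MF ie.
  by move=> i; rewrite andbT => /andP[ei _]; rewrite MF ltnNge ei.
by rewrite mulmx_suml inner_sumr [RHS](big_nth z0).
Qed.

Lemma law_discreteE (s : 'M[C]_n) (B : set Z) :
  law s M B = (\sum_z (z \in B)%:R * born s (M [set z]))%:E.
Proof.
rewrite -born_sumZ; congr (born s _)%:E; rewrite discrete_povmE.
by apply: eq_bigr => z _; rewrite rmorph_nat.
Qed.

Lemma integral_law_discrete (s : 'M[C]_n) (f : discrete z0 -> \bar R) :
  (forall z, 0 <= born s (M [set z])) -> (forall z, 0 <= f z)%E ->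
  (\int[law s M]_(x in setT) f x = \sum_(z : Z) (born s (M [set z]))%:E * f z)%E.
Proof.
move=> s0 f0; pose e := index_enum Z.
(* [law s M] is a bare set function. Writing it as a finite sum of weighted Dirac measures gives
   access to the rules for integrals. *)
pose m k : {measure set (discrete z0) -> \bar R} :=
  mscale (NngNum (s0 (nth z0 e k))) (dirac (nth z0 e k : discrete z0)).
have -> : law s M = msum m (size e).
  apply/funext => B; rewrite law_discreteE /msum -sumEFin.
  rewrite (big_nth z0) big_mkord.
  apply: eq_bigr => i _; rewrite /m /= /mscale /= /dirac indicE.
  by rewrite -EFinM mulrC.
have mf : measurable_fun setT f by [].
rewrite ge0_integral_measure_sum//.
rewrite [RHS](big_nth z0) big_mkord; apply: eq_bigr => i _.
by rewrite ge0_integral_mscale// integral_dirac//= diracE in_setT mul1e.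
Qed.

End DiscretePOVM.

(** * A finite dual family extracted from identifiability *)

Section DualFamily.
Context (F : fieldType) (I : Type) (Z : finType) (p : I -> Z -> F)
  (p_separates : forall a : Z -> F,
    (forall i, \sum_z p i z * a z = 0) -> forall z, a z = 0).

Let pmx k (e : 'I_k -> I) : 'M[F]_(k, #|Z|) :=
  \matrix_(j, l) p (e j) (enum_val l).

Let pmx_mul k (e : 'I_k -> I) (v : 'rV[F]_#|Z|) j :
  (pmx e *m v^T) j 0 = \sum_z p (e j) z * v 0 (enum_rank z).
Proof.
rewrite mxE (reindex_onto enum_rank enum_val) => [|l _]; last exact: enum_valK.
apply: eq_big => [z|z _]; first by rewrite enum_rankK eqxx.
by rewrite !mxE enum_rankK.
Qed.

(** Greedy choice: as long as fewer than [#|Z|] rows are chosen, some nonzero [v] is annihilated by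
    all of them, and separation yields an index whose row does not annihilate [v] and can be
    added. *)
Lemma free_family_exists k : (k <= #|Z|)%N -> exists e : 'I_k -> I, row_free (pmx e).
Proof.
elim: k => [_|k IHk kZ].
  have e : 'I_0 -> I by case.
  by exists e; rewrite /row_free flatmx0 mxrank0.
have [e free_e] := IHk (ltnW kZ).
(* Otherwise the transpose would have rank [#|Z|] with only [k] columns. *)
have [v ve0 v0] : exists2 v : 'rV[F]_#|Z|, pmx e *m v^T = 0 & v != 0.
  apply: contrapT => noker.
  have : row_free (pmx e)^T.
    apply: inj_row_free => v v0; apply: contrapT => /eqP vN0.
    by apply: noker; exists v => //; rewrite -[LHS]trmxK trmx_mul trmxK v0 trmx0.
  move=> /eqP; have := rank_leq_col (pmx e)^T => /[swap] ->.
  by rewrite leqNgt kZ.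
have [i vi] : exists i, \sum_z p i z * v 0 (enum_rank z) != 0.
  apply: contrapT => /forallNP vi; move/eqP: v0; apply.
  apply/rowP => l; rewrite mxE -(enum_valK l).
  apply: (p_separates (a := fun z => v 0 (enum_rank z))) => i.
  by apply/eqP/negPn/negP/vi.
exists (fun j : 'I_k.+1 => if unlift ord0 j is Some j' then e j' else i).
apply: inj_row_free => x x0.
set e' := (fun j => _) in x0.
(* Pairing the relation [x] with [v] removes the old rows and leaves the new row, placed at [ord0],
   with a nonzero factor. *)
have x00 : x 0 ord0 = 0.
  have : (x *m pmx e' *m v^T) 0 0 = 0 by rewrite x0 mul0mx mxE.
  rewrite -mulmxA mxE big_ord_recl big1 => [|j _].
    rewrite addr0 pmx_mul /e' unlift_none => /eqP.
    by rewrite mulf_eq0 (negbTE vi) orbF => /eqP.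
  rewrite pmx_mul /e' liftK -pmx_mul ve0 mxE mulr0.
  by [].
have xl : (\row_j x 0 (lift ord0 j)) *m pmx e = 0.
  apply/rowP => l; have /rowP/(_ l) := x0.
  rewrite !mxE big_ord_recl x00 mul0r add0r => xl; rewrite -[RHS]xl.
  by apply: eq_bigr => j _; rewrite !mxE /e' liftK.
apply/rowP => j; rewrite [RHS]mxE; case: (unliftP ord0 j) => [j' ->|-> //].
have := row_free_inj free_e (etrans xl (esym (mul0mx _ _))).
by move=> /rowP/(_ j'); rewrite !mxE.
Qed.

(** A free family of full size gives an invertible square matrix, and [c] consists of the rows of
    its inverse. *)
Lemma dual_coefficients : exists (e : 'I_#|Z| -> I) (c : Z -> 'I_#|Z| -> F),
  forall z w, \sum_j c z j * p (e j) w = (z == w)%:R.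
Proof.
have [e free_e] := free_family_exists (leqnn _).
exists e, (fun z j => invmx (pmx e) (enum_rank z) j) => z w.
have /mulVmx/matrixP/(_ (enum_rank z) (enum_rank w)) : pmx e \in unitmx.
  by rewrite -row_free_unit.
rewrite !mxE (inj_eq enum_rank_inj) => <-.
by apply: eq_bigr => j _; rewrite !mxE enum_rankK.
Qed.

End DualFamily.

Lemma ReK_ge0 (R : rcfType) (z : R[i]) : 0 <= z -> (complex.Re z)%:C = z.
Proof. by case: z => x y; rewrite lecE => /andP[/eqP /= -> _]. Qed.

(** * Sufficiency applied to an invariant effect *)

Section Sufficiency.
Context (R : realType) (G : topGroupType) (n : nat) (U : G -> 'M[R[i]]_n)
  (I : Type) (Q : I -> 'M[R[i]]_n) (Z : finType) (z0 : Z)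
  (Mstar : povm R n (discrete z0)).

Lemma qc_sufficient_born (E : 'M[R[i]]_n) :
  qc_sufficient Q (invariant_povms U) Mstar ->
  (forall g, (U g)^t* *m U g = 1%:M) ->
  (forall i z, 0 <= born (Q i) (Mstar [set z])) ->
  positive_op E -> positive_op (1%:M - E) ->
  (forall g, (U g)^t* *m E *m U g = E) ->
  exists2 k : Z -> R, (forall z, 0 <= k z) &
    forall i, born (Q i) E = \sum_(z : Z) born (Q i) (Mstar [set z]) * k z.
Proof.
move=> [_ suff] UU p0 E0 E1 EU.
have [|K KE] := suff _ _ (binary_povm E0 E1).
  split=> [|g B _]; first exact: standard_borel_R.
  rewrite /= /binary_op mulmxDr mulmxDl -!scalemxAr -!scalemxAl EU.
  by rewrite mulmxBr mulmx1 mulmxBl UU EU.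
have Kfin (z : Z) : (K (z : discrete z0) [set (1 : R)]) \is a fin_num.
  rewrite ge0_fin_numE//; apply: (@le_lt_trans _ _ 1%E); last exact: ltry.
  rewrite -(prob_kernel (s := K) z); apply: le_measure; rewrite ?inE//.
(* [k z] is the probability, under the kernel simulating the two-outcome measurement, of the outcome
   1 given the label [z]; it inherits independence of [i] from the kernel. *)
exists (fun z => fine (K (z : discrete z0) [set (1 : R)])) => [z|i].
  exact: fine_ge0.
have := KE i [set (1 : R)] (measurable_set1 _).
rewrite integral_law_discrete// /law binary_povm1 => KEi.
apply: EFin_inj; rewrite KEi -sumEFin; apply: eq_bigr => z _.
by rewrite EFinM fineK.
Qed.

End Sufficiency.

(** * Construction of the block states and the decomposition *)

Theorem theorem4p4 (R : realType)
  (G : topGroupType) (G_compact : compact [set: G])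
  (G_hausdorff : hausdorff_space G)
  (mu : probability (borel G) R) (mu_haar : is_haar mu)
  (d : measure_display) (Theta : measurableType d)
  (act : G -> Theta -> Theta) (act_action : measurable_action act)
  (n : nat) (U : G -> 'M[R[i]]_n) (U_rep : unitary_rep U)
  (rho : Theta -> 'M[R[i]]_n) (rho_density : forall t, density (rho t))
  (rho_covariant : forall g t, rho (act g t) = U g *m rho t *m (U g)^t*)
  (Z : finType) (z0 : Z)
  (H : Z -> {vspace 'cV[R[i]]_n}) (H_decomposition : orth_decomposition H)
  (Pi : Z -> 'M[R[i]]_n) (Pi_proj : forall z, orth_proj (Pi z) (H z))
  (Pi_central : forall z, central_in (commutant U) (Pi z))
  (identifiable : forall a : Z -> R,
     (forall eta : orbit_space act,
        \sum_z born (orbit_avg mu U rho eta) (Pi z) * a z = 0) ->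
     forall z, a z = 0)
  (Mstar : povm R n (discrete z0)) (Mstar_blocks : forall z, Mstar [set z] = Pi z)
  (Mstar_sufficient : qc_sufficient
     (fun eta : orbit_space act => orbit_avg mu U rho eta)
     (invariant_povms U) Mstar) :
  exists tau : Z -> 'M[R[i]]_n,
    (forall z, density (tau z) /\ supported_on (tau z) (H z)) /\
    forall eta : orbit_space act,
      orbit_avg mu U rho eta =
      \sum_z (born (orbit_avg mu U rho eta) (Pi z))%:C *: tau z.
Proof.
pose Q (eta : orbit_space act) := orbit_avg mu U rho eta.
pose p (eta : orbit_space act) (z : Z) := born (Q eta) (Pi z).
have Qpos eta : positive_op (Q eta).
  by apply: (twirl_positive mu U_rep); exact: (rho_density _).1.
have pE eta z : \tr (Q eta *m Pi z) = (p eta z)%:C.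
  by rewrite [RHS]ReK_ge0//; apply: mxtrace_positive_proj_ge0 (Pi_proj z).
have p0 eta z : 0 <= p eta z.
  by rewrite -lecR -pE; apply: mxtrace_positive_proj_ge0 (Pi_proj z).
have quadE v : inner v v = 1 -> exists2 k : Z -> R, (forall z, 0 <= k z) &
    forall eta, inner v (Q eta *m v) = (\sum_z p eta z * k z)%:C.
  move=> v1; pose E := cotwirl mu U (v *m v^t*).
  have E1 : positive_op (1%:M - E).
    rewrite /E -(cotwirlB1 mu U_rep); apply: (cotwirl_positive mu U_rep).
    exact: rank1_compl_positive.
  have E0 : positive_op E.
    by apply: (cotwirl_positive mu U_rep); exact: rank1_positive.
  have [|k k0 kE] := qc_sufficient_born Mstar_sufficient
      (unitary_trmxCl U_rep) _ E0 E1 (cotwirl_invariant mu_haar U_rep _).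
    by move=> eta z; rewrite Mstar_blocks; exact: p0.
  exists k => // eta.
  have -> : \sum_z p eta z * k z = born (Q eta) E.
    by rewrite kE; apply: eq_bigr => z _; rewrite Mstar_blocks.
  (* On an averaged state, [E] has the same trace pairing as the rank-one projection on [v]. *)
  rewrite /born [\tr _](mxtrace_twirl_cotwirl mu_haar U_rep) -inner_mulmx_tr.
  by rewrite ReK_ge0//; exact: Qpos.
have [e [c cE]] := @dual_coefficients R _ Z p identifiable.
pose tau z := \sum_j (c z j)%:C *: Q (e j).
(* Exchanging the sums over [j] and over labels lets the duality relation [cE] isolate [k z]. *)
have tauE v (k : Z -> R) : (forall eta, inner v (Q eta *m v) = (\sum_z p eta z * k z)%:C) ->
    forall z, inner v (tau z *m v) = (k z)%:C.
  move=> kE z; rewrite mulmx_suml inner_sumr.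
  transitivity ((\sum_w (\sum_j c z j * p (e j) w) * k w)%:C : R[i]); last first.
    congr (_%:C); rewrite (bigD1 z)//= cE eqxx mul1r big1 ?addr0// => w wz.
    by rewrite cE eq_sym (negbTE wz) mul0r.
  under [in RHS]eq_bigr do rewrite mulr_suml.
  rewrite exchange_big rmorph_sum; apply: eq_bigr => j _ /=.
  rewrite -scalemxAl innerZr kE -rmorphM mulr_sumr; congr (_%:C).
  by apply: eq_bigr => w _; rewrite mulrA.
(* The coefficients [c z j] may be negative, so positivity is drawn from the kernel values [k z] and
   not from that of the [Q (e j)]. *)
have tau_pos z : positive_op (tau z).
  apply: inner_unit_ge0_positive => v /quadE[k k0 kE].
  by rewrite (tauE v k kE) lecR.
have tau_Pi z w : \tr (tau z *m Pi w) = (z == w)%:R.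
  rewrite mulmx_suml [LHS]raddf_sum -[RHS](rmorph_nat (real_complex R)) -cE rmorph_sum.
  by apply: eq_bigr => j _; rewrite /= -scalemxAl mxtraceZ pE rmorphM.
have PiT := sum_orth_proj H_decomposition Pi_proj.
exists tau; split=> [z|eta].
  split; first split => //.
    rewrite -[tau z]mulmx1 -PiT mulmx_sumr [LHS]raddf_sum (bigD1 z)//= tau_Pi eqxx.
    by rewrite big1 ?addr0// => w wz; rewrite tau_Pi eq_sym (negbTE wz).
  (* For [w] other than [z] the trace of [tau z *m Pi w] is 0, so by positivity the product itself
     vanishes. Taking adjoints afterwards puts the range of [tau z] inside [H z]. *)
  have tauPi : tau z *m Pi z = tau z.
    rewrite -[RHS]mulmx1 -PiT mulmx_sumr (bigD1 z)//= big1 ?addr0// => w wz.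
    apply: mxtrace_positive_proj_eq0 (Pi_proj w) _ => //.
    by rewrite tau_Pi eq_sym (negbTE wz).
  have Pitau : tau z = Pi z *m tau z.
    rewrite -[LHS](positive_op_herm (tau_pos z)) -tauPi trmx_mul map_mxM.
    by rewrite (orth_proj_herm (Pi_proj z)) (positive_op_herm (tau_pos z)) tauPi.
  by move=> v; rewrite Pitau -mulmxA; exact: (Pi_proj z _).1.
rewrite -/(Q eta); set S := \sum_z _.
have quad0 v : inner v v = 1 -> inner v ((Q eta - S) *m v) = 0.
  move=> /quadE[k _ kE]; rewrite mulmxBl innerBr kE mulmx_suml inner_sumr.
  rewrite rmorph_sum -sumrB big1// => z _.
  by rewrite -scalemxAl innerZr (tauE v k kE) -rmorphM subrr.
apply/eqP; rewrite -subr_eq0; apply/eqP; apply: quadratic_form_eq0 => v.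
(* The form of [Q eta - S] is known to vanish at unit vectors; applying the scaling lemma to this
   operator and to its negative covers all vectors. *)
apply/le_anti/andP; split; last first.
  by apply: inner_unit_ge0_positive => w /quad0 ->.
have : positive_op (- (Q eta - S)).
  by apply: inner_unit_ge0_positive => w /quad0; rewrite mulNmx innerNr => ->; rewrite oppr0.
by move=> /(_ v); rewrite mulNmx innerNr oppr_ge0.
Qed.
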